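(* For every split graph $G$, the number of maximal independent sets of $G$ is either $\omega(G)$ or $\omega(G)+1$. Moreover, for every split graph $G$ on $n$ vertices that is given together with a split partition, all maximal independent sets of $G$ can be counted and enumerated in time $O(\omega(G)\cdot n)$.
   Context: All graphs are finite, simple and undirected. A split graph is a graph whose vertex set $V$ can be partitioned into a clique $K$ and an independent set $S$, either of which may be empty. Such a pair $(K,S)$ is a split partition. There is no restriction on the edges between $K$ and $S$. $\omega(G)$ denotes the size of a largest clique of $G$. A maximal independent set is an independent set that is not a proper subset of another independent set. *)

(* Defs.v *)
From mathcomp Require Import all_boot.

Set Implicit Arguments.
Unset Strict Implicit.
Unset Printing Implicit Defensive.

Section Graphs.
Variables (T : finType) (e : rel T).

Definition simple_graph : Prop := symmetric e /\ irreflexive e.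

Definition clique (A : {set T}) : bool :=
  [forall x in A, forall y in A, (x != y) ==> e x y].

Definition independent (A : {set T}) : bool :=
  [forall x in A, forall y in A, ~~ e x y].

Definition split_partition (K S : {set T}) : Prop :=
  [/\ K :|: S = [set: T], [disjoint K & S], clique K & independent S].

Definition split_graph : Prop := exists K S : {set T}, split_partition K S.

Definition omega : nat := \max_(A : {set T} | clique A) #|A|.

Definition max_indep_sets : {set {set T}} :=
  [set I : {set T} | maxset independent I].

End Graphs.

(* Model of computation: a unit-cost word RAM, programmed in structured form.
   A machine has variables (a given program only mentions finitely many of
   them), a random-access memory and a write-only output stream, all holding
   words, i.e., natural numbers smaller than a bound W. *)

Record state := State {
  vars : nat -> nat;
  mem : nat -> nat;
  out : seq nat }.

Inductive instr :=
  | Const (x k : nat)     (* x := k *)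
  | Add (x y z : nat)     (* x := y + z *)
  | Sub (x y z : nat)     (* x := y - z, truncated at 0 *)
  | Read (x y : nat)      (* x := mem[y] *)
  | Write (x y : nat)     (* mem[x] := y *)
  | Emit (x : nat).       (* append x to the output *)

Inductive cmd :=
  | Skip
  | Instr (i : instr)
  | Seq (p q : cmd)
  | If (x : nat) (p q : cmd)
  | While (x : nat) (p : cmd).

Definition update (f : nat -> nat) (a v : nat) : nat -> nat :=
  fun b => if b == a then v else f b.

(* The word that an instruction writes to a variable, a cell or the output. *)
Definition written (i : instr) (s : state) : nat :=
  match i with
  | Const _ k => k
  | Add _ y z => vars s y + vars s z
  | Sub _ y z => vars s y - vars s z
  | Read _ y => mem s (vars s y)
  | Write _ y => vars s y
  | Emit x => vars s x
  end.

Definition run_instr (i : instr) (s : state) : state :=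
  let v := written i s in
  match i with
  | Const x _ | Add x _ _ | Sub x _ _ | Read x _ =>
      State (update (vars s) x v) (mem s) (out s)
  | Write x _ => State (vars s) (update (mem s) (vars s x) v) (out s)
  | Emit _ => State (vars s) (mem s) (rcons (out s) v)
  end.

(* [exec W p s t s']: started in state s, program p halts in state s' after
   exactly t steps.  Each instruction and each test costs one step.  A run
   that would write a value that is not a word (an overflow) is stuck. *)
Inductive exec (W : nat) : cmd -> state -> nat -> state -> Prop :=
  | ExecSkip s : exec W Skip s 1 s
  | ExecInstr i s : written i s < W -> exec W (Instr i) s 1 (run_instr i s)
  | ExecSeq p q s1 t1 s2 t2 s3 :
      exec W p s1 t1 s2 -> exec W q s2 t2 s3 ->
      exec W (Seq p q) s1 (t1 + t2) s3
  | ExecIfTrue x p q s t s' :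
      vars s x != 0 -> exec W p s t s' -> exec W (If x p q) s t.+1 s'
  | ExecIfFalse x p q s t s' :
      vars s x = 0 -> exec W q s t s' -> exec W (If x p q) s t.+1 s'
  | ExecWhileTrue x p s1 t1 s2 t2 s3 :
      vars s1 x != 0 -> exec W p s1 t1 s2 -> exec W (While x p) s2 t2 s3 ->
      exec W (While x p) s1 (t1 + t2).+1 s3
  | ExecWhileFalse x p s :
      vars s x = 0 -> exec W (While x p) s 1 s.

(* The input is a sequence of words stored in memory from address 0 on. *)
Definition init (w : seq nat) : state :=
  State (fun _ => 0) (fun a => nth 0 w a) [::].

Definition char_vector (n : nat) (A : {set 'I_n}) : seq nat :=
  [seq nat_of_bool (i \in A) | i <- enum 'I_n].

Definition adj_matrix (n : nat) (e : rel 'I_n) : seq nat :=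
  [seq nat_of_bool (e i j) | i <- enum 'I_n, j <- enum 'I_n].

(* n + 1 pointers followed by the concatenated neighbour lists; when this block
   is stored at address [base], the neighbours of vertex i occupy the addresses
   from the i-th pointer (included) to the (i + 1)-st one (excluded). *)
Definition adj_lists (n : nat) (base : nat) (adj : 'I_n -> seq 'I_n) : seq nat :=
  let lists := [seq [seq nat_of_ord j | j <- adj i] | i <- enum 'I_n] in
  [seq base + n.+1 + sumn (take i (shape lists)) | i <- iota 0 n.+1]
    ++ flatten lists.

Inductive graph_format := AdjMatrix | AdjLists.

(* [encodes fmt e K w]: w is an input made of the number n of vertices, the
   split partition (K, ~: K) as a 0/1 vector, and the graph e in the format
   fmt.  Neighbour lists may come in any order. *)
Definition encodes (fmt : graph_format) (n : nat) (e : rel 'I_n)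
    (K : {set 'I_n}) (w : seq nat) : Prop :=
  match fmt with
  | AdjMatrix => w = n :: char_vector K ++ adj_matrix e
  | AdjLists =>
      exists adj : 'I_n -> seq 'I_n,
        [/\ forall i, uniq (adj i),
            forall i j, (j \in adj i) = e i j
          & w = n :: char_vector K ++ adj_lists n.+1 adj]
  end.

(* o lists every member of F exactly once, in some order, each member being
   written as a 0/1 vector of length n. *)
Definition enumerates (n : nat) (F : {set {set 'I_n}}) (o : seq nat) : Prop :=
  exists2 L : seq {set 'I_n},
    perm_eq L (enum F) & o = flatten [seq char_vector A | A <- L].

(* Main.v *)
(** In a split graph with partition (K, S), a maximal independent set meets K in
    at most one vertex.  If it contains v in K, it is the set of all
    non-neighbours of v, which is always maximal; otherwise it is S, which is
    maximal iff every vertex of K has a neighbour in S.  Hence there are |K| or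
    |K| + 1 of them.  Since |K| <= omega <= |K| + 1, and omega = |K| as soon as
    some vertex of K has no neighbour in S, the count is omega or omega + 1.
    To enumerate, a program outputs the complemented adjacency row of each vertex
    of K in time O(n), noting whether that vertex has a neighbour in S, and
    finally outputs S if all of them do; scanning K takes O(n) more steps, and
    omega >= 1 when n > 0. *)

From mathcomp Require Import all_boot zify.
Require Import Defs.

Set Implicit Arguments.
Unset Strict Implicit.
Unset Printing Implicit Defensive.

(** * Maximal independent sets and cliques of a split graph *)

Section SplitGraphs.
Variables (T : finType) (e : rel T).

Lemma cliqueP (A : {set T}) :
  reflect {in A &, forall x y, x != y -> e x y} (clique e A).
Proof.
apply: (iffP forall_inP) => [h x y xA yA | h x xA].
  by move: (forall_inP (h x xA) y yA) => /implyP.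
by apply/forall_inP => y yA; apply/implyP; apply: h.
Qed.

Lemma independentP (A : {set T}) :
  reflect {in A &, forall x y, ~~ e x y} (independent e A).
Proof.
apply: (iffP forall_inP) => [h x y xA yA | h x xA].
  exact: (forall_inP (h x xA) y yA).
by apply/forall_inP => y; apply: h.
Qed.

Definition non_neighbours (v : T) : {set T} := [set u | ~~ e v u].

(** A sequence rather than a set, ordered as [mis_program] outputs its members, so that it can serve
    as the witness in [enumerates]. *)
Definition split_mis_list (K S : {set T}) : seq {set T} :=
  [seq non_neighbours v | v <- enum K] ++
  (if [forall v in K, exists u in S, e v u] then [:: S] else [::]).

Lemma size_split_mis_list K S : size (split_mis_list K S) =
  #|K| + [forall v in K, exists u in S, e v u].
Proof. by rewrite size_cat size_map -cardE; case: ifP. Qed.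

Lemma clique_le_omega (A : {set T}) : clique e A -> #|A| <= omega e.
Proof. by move=> cA; apply: (leq_bigmax_cond (F := fun A : {set T} => #|A|)). Qed.

Lemma omega_gt0 : 0 < #|T| -> 0 < omega e.
Proof.
case/card_gt0P => x _; rewrite -(cards1 x); apply: clique_le_omega.
by apply/cliqueP => y z /set1P-> /set1P->; rewrite eqxx.
Qed.

Variables (K S : {set T}).
Hypotheses (simple_e : simple_graph e) (splitKS : split_partition e K S).

Let sym_e : symmetric e. Proof. by case: simple_e. Qed.
Let irr_e : irreflexive e. Proof. by case: simple_e. Qed.
Let eK x y : x \in K -> y \in K -> x != y -> e x y.
Proof. by case: splitKS => _ _ /cliqueP h _; apply: h. Qed.
Let eS x y : x \in S -> y \in S -> ~~ e x y.
Proof. by case: splitKS => _ _ _ /independentP h; apply: h. Qed.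

Lemma split_partitionC x : (x \in S) = (x \notin K).
Proof.
case: splitKS => cover disj _ _.
have: x \in K :|: S by rewrite cover inE.
rewrite inE; case: (boolP (x \in K)) => //= xK _.
by rewrite (disjointFr disj xK).
Qed.

(** Since [K] is a clique, every non-neighbour of [v] other than [v] lies in [S]. Since [v] is its
    own non-neighbour, an independent superset contains [v] and hence no neighbour of [v]. *)
Lemma maxset_non_neighbours v : v \in K ->
  maxset (independent e) (non_neighbours v).
Proof.
have inS x : x \in non_neighbours v -> v \in K -> x != v -> x \in S.
  rewrite inE split_partitionC => nevx vK nxv.
  by apply: contra nevx => xK; apply: eK; rewrite // eq_sym.
move=> vK; apply/maxsetP; split=> [|B indB sub].
  apply/independentP => x y xI yI.
  have [-> | nxv] := eqVneq x v; first by move: yI; rewrite inE.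
  have [-> | nyv] := eqVneq y v; first by move: xI; rewrite inE sym_e.
  by apply: eS; apply: inS.
apply/eqP; rewrite eqEsubset sub andbT; apply/subsetP => x xB.
rewrite inE; apply: (independentP _ indB) => //.
by apply: (subsetP sub); rewrite inE irr_e.
Qed.

(** The only way to enlarge [S] is to add a vertex of [K], and [v |: S] is independent exactly when
    [v] has no neighbour in [S]. *)
Lemma maxset_split_indep :
  maxset (independent e) S = [forall v in K, exists u in S, e v u].
Proof.
apply/maxsetP/forall_inP => [[_ maxS] v vK | nbr].
  apply: contraTT vK; rewrite negb_exists_in => /forall_inP nov.
  rewrite -split_partitionC -(maxS (v |: S)) ?subsetUr ?setU11 //.
  apply/independentP => x y; rewrite !inE.
  case/predU1P => [-> | xS]; case/predU1P => [-> | yS]; rewrite ?irr_e //.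
  - exact: nov.
  - by rewrite sym_e; apply: nov.
  - exact: eS.
split=> [|B indB sub]; first by case: splitKS.
apply/eqP; rewrite eqEsubset sub andbT; apply/subsetP => x xB.
rewrite split_partitionC; apply/negP => /nbr/exists_inP[u uS].
by apply/negP; apply: (independentP _ indB) => //; apply: (subsetP sub).
Qed.

Lemma mem_split_mis_list I :
  (I \in split_mis_list K S) = maxset (independent e) I.
Proof.
rewrite mem_cat; apply/orP/idP => [[/mapP[v] | ]|maxI].
- by rewrite mem_enum => vK ->; apply: maxset_non_neighbours.
- by case: ifP => // /[!inE] h /eqP->; rewrite maxset_split_indep.
have [indI maxI'] := maxsetP maxI.
(* Either [I] lies inside the independent set [S] and equals it by maximality, or it contains some
   [v] of [K] and lies inside [non_neighbours v]. *)
have [sIS | /subsetPn[v vI]] := boolP (I \subset S).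
  have indS : independent e S by case: splitKS.
  have IS := maxI' S indS sIS.
  by right; rewrite -maxset_split_indep {1}IS maxI mem_seq1 IS.
rewrite split_partitionC negbK => vK.
left; apply/mapP; exists v; first by rewrite mem_enum.
have [indN _] := maxsetP (maxset_non_neighbours vK).
apply/esym/maxI' => //; apply/subsetP => x xI.
by rewrite inE; apply: (independentP _ indI).
Qed.

Lemma perm_split_mis_list :
  perm_eq (split_mis_list K S) (enum (max_indep_sets e)).
Proof.
apply: uniq_perm; rewrite ?enum_uniq //; last first.
  by move=> I; rewrite mem_enum inE mem_split_mis_list.
(* No repetitions: [v] separates [non_neighbours v] from [S] and from [non_neighbours y] for every
   other [y] in [K]. *)
rewrite cat_uniq map_inj_in_uniq ?enum_uniq /=.
  case: ifP; rewrite //= orbF andbT => _; apply/mapP => -[v].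
  rewrite mem_enum => vK /setP/(_ v).
  by rewrite inE irr_e split_partitionC vK.
move=> x y; rewrite !mem_enum => xK yK /setP/(_ x); rewrite !inE irr_e.
by have [//| nxy] := eqVneq x y; rewrite sym_e eK.
Qed.

Lemma card_max_indep_sets_split :
  #|max_indep_sets e| = #|K| + [forall v in K, exists u in S, e v u].
Proof.
by rewrite cardE -(perm_size perm_split_mis_list) size_split_mis_list.
Qed.

Lemma card_le_omega : #|K| <= omega e.
Proof. by apply: clique_le_omega; case: splitKS. Qed.

Lemma clique_meets_indep_once C : clique e C -> #|C :&: S| <= 1.
Proof.
move/cliqueP => cC; rewrite leqNgt; apply/negP.
case/card_gt1P => x [y [/setIP[xC xS] /setIP[yC yS] nxy]].
by move: (eS xS yS); rewrite cC.
Qed.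

Lemma card_split_clique (C : {set T}) : #|C| = #|C :&: K| + #|C :&: S|.
Proof.
rewrite -(cardsID K C); congr (_ + #|pred_of_set _|).
by apply/setP => x; rewrite !inE split_partitionC andbC.
Qed.

(** A clique has at most one vertex in [S]. If it has one and some [v] in [K] has no neighbour in
    [S], the clique misses [v], which makes up for the extra vertex. *)
Lemma omega_le_split : omega e <= #|K| + [forall v in K, exists u in S, e v u].
Proof.
apply/bigmax_leqP => C cC; rewrite card_split_clique.
have C1 := clique_meets_indep_once cC.
have CK : #|C :&: K| <= #|K| by rewrite subset_leq_card ?subsetIr.
case: (boolP [forall v in K, _]) => [_|]; first exact: leq_add.
rewrite negb_forall_in => /exists_inP[v vK nov]; rewrite addn0.
have [->|/set0Pn[u /setIP[uC uS]]] := eqVneq (C :&: S) set0.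
  by rewrite cards0 addn0.
rewrite (leq_trans (leq_add (leqnn _) C1)) // addn1; apply: proper_card.
apply: (@sub_proper_trans _ _ (K :\ v)); last exact: properD1.
apply/subsetP => x /setIP[xC xK]; rewrite !inE xK andbT.
apply: contra nov => /eqP xv; apply/exists_inP; exists u => //.
apply: (cliqueP _ cC) => //; first by rewrite -xv.
by apply: contraTneq uS => <-; rewrite split_partitionC vK.
Qed.

(** With b the truth value above, the count is |K| + b and omega lies between |K| and |K| + b, so
    they differ by at most one. *)
Lemma card_max_indep_sets_omega :
  #|max_indep_sets e| = omega e \/ #|max_indep_sets e| = omega e + 1.
Proof.
have := omega_le_split; have := card_le_omega.
rewrite card_max_indep_sets_split; case: [forall v in K, _] => /=; lia.
Qed.

End SplitGraphs.

(** * Program logic: total correctness with time bounds *)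

Section Runs.
Variable W : nat.

Definition runs (p : cmd) (s : state) (T : nat) (Q : state -> Prop) : Prop :=
  exists t s', [/\ exec W p s t s', t <= T & Q s'].

Lemma runs_weaken p s T T' (Q Q' : state -> Prop) :
  runs p s T Q -> T <= T' -> (forall s', Q s' -> Q' s') -> runs p s T' Q'.
Proof.
move=> [t [s' [ex tT q]]] TT' imp; exists t, s'; split=> //; last exact: imp.
exact: leq_trans TT'.
Qed.

Lemma runs_skip s T (Q : state -> Prop) : 0 < T -> Q s -> runs Skip s T Q.
Proof. by move=> T0 q; exists 1, s; split=> //; apply: ExecSkip. Qed.

Lemma runs_seq p q s T1 T2 (Q : state -> Prop) :
  runs p s T1 (fun s' => runs q s' T2 Q) -> runs (Seq p q) s (T1 + T2) Q.
Proof.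
move=> [t1 [s1 [ex1 le1 [t2 [s2 [ex2 le2 q2]]]]]].
exists (t1 + t2), s2; split=> //; last exact: leq_add.
exact: ExecSeq ex1 ex2.
Qed.

Lemma runs_if x p q s T (Q : state -> Prop) :
  (vars s x != 0 -> runs p s T Q) -> (vars s x = 0 -> runs q s T Q) ->
  runs (If x p q) s T.+1 Q.
Proof.
have [x0 _ /(_ x0)|x0 /(_ isT) + _] := eqVneq (vars s x) 0.
  by move=> [t [s' [ex le q']]]; exists t.+1, s'; split=> //; apply: ExecIfFalse.
by move=> [t [s' [ex le q']]]; exists t.+1, s'; split=> //; apply: ExecIfTrue.
Qed.

(** The time bound may depend on the iteration: in the main loop, vertices of the clique cost O(n)
    and the others O(1). *)
Lemma runs_while (I : nat -> state -> Prop) (T : nat -> nat) N x p s :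
  (forall i s, i < N -> I i s -> vars s x != 0 /\ runs p s (T i) (I i.+1)) ->
  (forall s, I N s -> vars s x = 0) ->
  I 0 s -> runs (While x p) s (\sum_(0 <= i < N) (T i).+1).+1 (I N).
Proof.
move=> step stop I0.
suff go k i s' : i + k = N -> I i s' ->
    runs (While x p) s' (\sum_(i <= j < N) (T j).+1).+1 (I N) by apply: (go N).
elim: k i s' => [|k IHk] i s'.
  rewrite addn0 => -> IN; exists 1, s'; split=> //.
  by apply: ExecWhileFalse; apply: stop.
move=> def_N Ii; have iN : i < N by lia.
have [x0 [t1 [s1 [ex1 le1 I1]]]] := step i s' iN Ii.
have [|t2 [s2 [ex2 le2 I2]]] := IHk i.+1 s1 _ I1; first by lia.
exists (t1 + t2).+1, s2; split=> //; first exact: ExecWhileTrue ex1 ex2.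
rewrite big_ltn //; lia.
Qed.

Lemma runs_while_const (I : nat -> state -> Prop) T N x p s :
  (forall i s, i < N -> I i s -> vars s x != 0 /\ runs p s T (I i.+1)) ->
  (forall s, I N s -> vars s x = 0) ->
  I 0 s -> runs (While x p) s (N * T.+1).+1 (I N).
Proof.
move=> step stop I0; have := runs_while (T := fun=> T) step stop I0.
by rewrite sum_nat_const_nat subn0.
Qed.

Definition block (l : seq instr) : cmd := foldr (fun i => Seq (Instr i)) Skip l.

(** Collects the overflow conditions of straight-line code, so that a block reduces to one
    arithmetic goal and one goal on the final state. *)
Fixpoint fits (l : seq instr) (s : state) : Prop :=
  if l is i :: l' then written i s < W /\ fits l' (run_instr i s) else True.

Lemma runs_block l s (Q : state -> Prop) :
  fits l s -> Q (foldl (fun s i => run_instr i s) s l) ->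
  runs (block l) s (size l).+1 Q.
Proof.
elim: l s => [|i l IHl] s /=; first by move=> _; apply: runs_skip.
move=> [wi fl] q; rewrite -add1n; apply: runs_seq; exists 1, (run_instr i s).
by split=> //; [apply: ExecInstr | apply: IHl].
Qed.

End Runs.

Arguments block : simpl never.

(** * The enumeration program and its output loop *)

Lemma take_enum_ord n (i : 'I_n) :
  take i.+1 (enum 'I_n) = rcons (take i (enum 'I_n)) i.
Proof. by rewrite (take_nth i) ?nth_ord_enum ?size_enum_ord. Qed.

Lemma take_enum_ord_all n : take n (enum 'I_n) = enum 'I_n.
Proof. by rewrite take_oversize ?size_enum_ord. Qed.

(* Variables: 0 number of sets output, 1 n, 2 constant one, 3 address of the
   membership bit of the current vertex, 4 vertices left, 5 address of its
   matrix row or list pointer, 6 whether some clique vertex seen so far has no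
   neighbour in S, 7 scratch area, 8 constant zero; the others are temporary. *)
Definition preserved (s s' : state) : Prop :=
  forall x, x < 9 -> vars s' x = vars s x.

(* Outputs the complement of the 0/1 row stored from address [vars s 9] on, and
   counts in variable 14 the ones of the row that lie outside the clique. *)
Definition emit_row : cmd :=
  Seq (block [:: Const 14 0; Add 10 1 8; Const 11 1])
      (While 10 (block [:: Read 12 9; Read 13 11; Sub 13 12 13; Add 14 14 13;
         Sub 12 2 12; Emit 12; Add 9 9 2; Add 11 11 2; Sub 10 10 2])).

(** The row [b] is arbitrary because the loop serves twice: on adjacency rows, and finally on the
    indicator of [K], whose complement is [S]. *)
Lemma runs_emit_row W n (b k : pred 'I_n) (s : state) (a := vars s 9) :
  n.+1 < W -> a + n < W ->
  vars s 1 = n -> vars s 2 = 1 -> vars s 8 = 0 ->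
  (forall j : 'I_n, mem s (a + j) = b j) ->
  (forall j : 'I_n, mem s j.+1 = k j) ->
  runs W emit_row s (11 * n + 5) (fun s' =>
    [/\ preserved s s', mem s' = mem s,
        out s' = out s ++ [seq nat_of_bool (~~ b j) | j <- enum 'I_n]
      & vars s' 14 = count (fun j => b j && ~~ k j) (enum 'I_n)]).
Proof.
move=> nW aW s1 s2 s8 mb mk.
pose I i s' := [/\ preserved s s', mem s' = mem s,
  out s' = out s ++ [seq nat_of_bool (~~ b j) | j <- take i (enum 'I_n)],
  vars s' 14 = count (fun j => b j && ~~ k j) (take i (enum 'I_n))
  & [/\ vars s' 9 = a + i, vars s' 10 = n - i & vars s' 11 = i.+1]].
(* A block costs one step more than its length, for the final [Skip]: 4 for the initialisation, and
   10 plus one test per iteration. *)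
apply: (@runs_weaken _ _ _ (4 + (n * 11).+1) _ (I n)); last 2 first.
- lia.
- by rewrite /I take_enum_ord_all => s' [].
apply: runs_seq; apply: runs_block; first by rewrite /= /update /= s1 s8; lia.
apply: (@runs_while_const _ I); last first.
- rewrite /I take0 cats0; split=> //=; last first.
    by rewrite /update /= s1 s8; split; rewrite ?addn0 ?subn0.
  by move=> x x9; rewrite /= /update; do ![case: eqP => [?|_]; first lia].
- by move=> s' [_ _ _ _ [_ ->]]; rewrite subnn.
move=> i s' iN [pres ms outs s14 [s9 s10 s11]].
split; first by rewrite s10; lia.
have := mb (Ordinal iN); have := mk (Ordinal iN); rewrite -/a /= => ki bi.
(* The counter is at most [i], so incrementing it does not overflow. *)
have cnt := count_size (fun j => b j && ~~ k j) (take i (enum 'I_n)).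
rewrite size_take size_enum_ord iN -s14 in cnt.
have p2 := pres 2 isT; rewrite s2 in p2.
apply: runs_block.
  rewrite /= /update /= ms s9 s10 s11 p2 ki bi.
  by case: (b _); case: (k _) => /=; lia.
have ti := take_enum_ord (Ordinal iN); rewrite /= in ti.
rewrite /I ti map_rcons -!cats1 count_cat /= /update /= ms s9 s10 s11 p2 ki bi.
split=> //=.
- move=> x x9; rewrite /= /update -(pres x x9).
  by do ![case: eqP => [?|_]; first lia].
- by rewrite outs cats1 rcons_cat; case: (b _).
(* On 0/1 words, truncated subtraction of [k] from [b] computes [b && ~~ k]. *)
- by rewrite s14; case: (b _); case: (k _) => /=; lia.
- by split; lia.
Qed.

(** The variable added to the row address after each vertex: variable 1 holds n, the length of a
    matrix row, and variable 2 holds one, the distance between list pointers. *)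
Definition stride_var (fmt : graph_format) : nat :=
  if fmt is AdjMatrix then 1 else 2.

Definition stride (fmt : graph_format) (n : nat) : nat :=
  if fmt is AdjMatrix then n else 1.

(** Variable 7 receives the word at address n + (n + 1). For neighbour lists this is the last
    pointer, that is, the first address behind the input. *)
Definition mis_program (fmt : graph_format) (row : cmd) : cmd :=
  Seq (block [:: Read 1 8; Const 2 1; Const 3 1; Add 4 1 8; Add 5 1 2;
                 Add 7 1 5; Read 7 7])
 (Seq (While 4
   (Seq (block [:: Read 12 3])
   (Seq (If 12 (Seq row
                  (Seq (block [:: Add 0 0 2]) (If 14 Skip (block [:: Const 6 1]))))
               Skip)
        (block [:: Add 3 3 2; Add 5 5 (stride_var fmt); Sub 4 4 2]))))
   (If 6 Skip
      (Seq (block [:: Const 9 1]) (Seq emit_row (block [:: Add 0 0 2]))))).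

(** * Correctness and running time of the program, relative to a row routine *)

Section Correctness.
Variables (fmt : graph_format) (n : nat) (e : rel 'I_n) (K S : {set 'I_n}).
Variables (w : seq nat) (W : nat).

(** What a row routine may assume at vertex [i]. Memory is compared pointwise because [list_row]
    restores it by further updates. *)
Definition ready (i : nat) (s : state) : Prop :=
  [/\ mem s =1 nth 0 w, vars s 5 = n.+1 + i * stride fmt n,
      vars s 7 = nth 0 w (n + n.+1)
    & [/\ vars s 1 = n, vars s 2 = 1 & vars s 8 = 0]].

Definition row_correct (row : cmd) (c : nat) : Prop :=
  forall (v : 'I_n) s, ready v s -> runs W row s (c * n + c) (fun s' =>
    [/\ preserved s s', mem s' =1 nth 0 w,
        out s' = out s ++ char_vector (non_neighbours e v)
      & vars s' 14 = count (fun u => e v u && (u \notin K)) (enum 'I_n)]).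

Hypotheses (simple_e : simple_graph e) (splitKS : split_partition e K S).
Hypothesis (W_large : n * n + 4 * n + 3 < W).
Hypotheses (w_n : nth 0 w 0 = n) (w_scratch : nth 0 w (n + n.+1) < W).
Hypothesis (w_K : forall i : 'I_n, nth 0 w i.+1 = (i \in K)).

Lemma runs_mis_program (row : cmd) (c : nat) : row_correct row c ->
  runs W (mis_program fmt row) (init w)
    (24 * n + 25 + (c * n + c) * #|K|) (fun s =>
      vars s 0 = #|max_indep_sets e| /\
      enumerates (max_indep_sets e) (out s)).
Proof.
move=> rowP.
pose isolated v := ~~ has (fun u => e v u && (u \notin K)) (enum 'I_n).
pose seen i := [seq v <- take i (enum 'I_n) | v \in K].
pose J i s := ready i s /\
  [/\ vars s 3 = i.+1, vars s 4 = n - i, vars s 0 = size (seen i),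
      vars s 6 = has isolated (seen i)
    & out s = flatten [seq char_vector (non_neighbours e v) | v <- seen i]].
(* The word at address i + 1 is the membership bit of vertex i, so the row routine is charged only
   for vertices of [K]; this yields the factor |K| in place of n. *)
pose T i := 12 + (c * n + c) * nth 0 w i.+1.
have sumT : \sum_(0 <= i < n) (T i).+1 = 13 * n + (c * n + c) * #|K|.
  rewrite big_mkord (eq_bigr (fun i : 'I_n => 13 + (c * n + c) * (i \in K))).
    rewrite big_split /= sum_nat_const card_ord -big_distrr /=.
    by rewrite -sum1_card [in RHS]big_mkcond /= (mulnC n); congr (_ + _ * _).
  by move=> i _; rewrite /T w_K.
have seenn : seen n = enum K.
  by rewrite /seen take_enum_ord_all [in RHS]/enum_mem -enumT.
apply: (@runs_weaken _ _ _ (8 + ((\sum_(0 <= i < n) (T i).+1).+1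
    + (2 + ((11 * n + 5) + 2)).+1)) _ _ _ _ _ (fun s q => q)); last first.
  rewrite sumT; lia.
apply: runs_seq; apply: runs_block.
  rewrite /= /update /= w_n addn1; lia.
apply: runs_seq; apply: (@runs_weaken _ _ _ _ _ (J n)); last 2 first.
- exact: leqnn.
- move=> s [[ms s5 s7 [s1 s2 s8]] [s3 s4]]; rewrite seenn => s0 s6 outs.
  have hasE : has isolated (enum K) = ~~ [forall v in K, exists u in S, e v u].
    rewrite negb_forall_in; apply/hasP/exists_inP => -[v vK iv].
      exists v; first by rewrite -mem_enum.
      apply: contra iv => /exists_inP[u uS evu]; apply/hasP.
      by exists u; rewrite ?mem_enum // evu -(split_partitionC splitKS).
    exists v; first by rewrite mem_enum.
    apply: contra iv => /hasP[u _ /andP[evu uK]]; apply/exists_inP.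
    by exists u; rewrite // (split_partitionC splitKS).
  rewrite (card_max_indep_sets_split simple_e splitKS).
  have perm_mis := perm_split_mis_list simple_e splitKS.
  apply: runs_if; rewrite s6 hasE.
    case A : [forall v in K, _] => // _.
    apply: runs_skip => //; split; first by rewrite s0 -cardE addn0.
    exists (split_mis_list e K S) => //.
    by rewrite outs /split_mis_list A cats0 -map_comp.
  case A : [forall v in K, _] => // _.
  (* The membership vector of [K], stored from address 1 on, is treated as a row; its complement is
     [S]. *)
  apply: runs_seq; apply: runs_block; first by rewrite /=; lia.
  apply: runs_seq.
  apply: (runs_weaken (runs_emit_row (b := [in K]) (k := [in K]) _ _ _ _ _ _ _)).
  + lia.
  + rewrite /= /update /=; lia.
  + exact: s1.
  + exact: s2.
  + exact: s8.
  + by move=> j; rewrite /= ms add1n w_K.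
  + by move=> j; rewrite /= ms w_K.
  + exact: leqnn.
  move=> s' [pres ms' outs' _]; apply: runs_block; rewrite /= /update /=.
    rewrite !pres //= /update /= s0 s2 -cardE; have := max_card K.
    rewrite card_ord; lia.
  rewrite !pres //= /update /= s0 s2 -cardE; split=> //.
  exists (split_mis_list e K S) => //.
  rewrite outs' /= outs /split_mis_list A map_cat flatten_cat /= cats0.
  congr (_ ++ _); first by rewrite -map_comp.
  apply: eq_map => j.
  by rewrite (split_partitionC splitKS).
apply: runs_while => [i s iN [rdy [s3 s4 s0 s6 outs]]||].
- have [ms s5 s7 [s1 s2 s8]] := rdy.
  split; first by rewrite s4; lia.
  have wi := w_K (Ordinal iN); rewrite /= in wi.
  have ti := take_enum_ord (Ordinal iN); rewrite /= in ti.
  have seenS : seen i.+1 =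
      if Ordinal iN \in K then rcons (seen i) (Ordinal iN) else seen i.
    by rewrite /seen ti filter_rcons.
  have size_seen : size (seen i) <= i.
    rewrite size_filter (leq_trans (count_size _ _)) //.
    by rewrite size_take size_enum_ord iN.
  have stride_le : n.+1 + i * stride fmt n + stride fmt n <= n.+1 + n * n.
    rewrite /stride; case: fmt; nia.
  (* Midpoint of the body: vertex [i] is already accounted for in the output, but the addresses and
     the loop counter have not moved yet. *)
  pose M s' := [/\ ready i s', vars s' 3 = i.+1, vars s' 4 = n - i
    & [/\ vars s' 0 = size (seen i.+1), vars s' 6 = has isolated (seen i.+1)
    & out s' = flatten [seq char_vector (non_neighbours e v) | v <- seen i.+1]]].
  apply: (@runs_weaken _ _ _ (2 + ((5 + (c * n + c) * nth 0 w i.+1).+1 + 4))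
            _ _ _ _ _ (fun s q => q)); last by rewrite /T; lia.
  apply: runs_seq; apply: runs_block; first by rewrite /= s3 ms wi; lia.
  apply: runs_seq; apply: (@runs_weaken _ _ _ _ _ M); last 2 first.
  + exact: leqnn.
  + move=> s' [[ms' s5' s7' [s1' s2' s8']] s3' s4' [s0' s6' outs']].
    have sv : vars s' (stride_var fmt) = stride fmt n.
      by rewrite /stride_var /stride; case: (fmt).
    apply: runs_block; rewrite /= /update.
      split; first by rewrite s3' s2'; lia.
      split; last by rewrite s4' s2' /=; lia.
      have -> : (stride_var fmt == 3) = false by case: (fmt).
      by rewrite /= s5' sv; lia.
    have -> : (stride_var fmt == 3) = false by case: (fmt).
    rewrite /J /ready /= s3' s2' s4' s5' sv; split; last by split=> //; lia.
    by split=> //; rewrite mulSn; lia.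
  apply: runs_if; rewrite /= /update /= s3 ms wi.
    rewrite /M seenS.
    case: ifP => // iK _.
    apply: (@runs_weaken _ _ _ (c * n + c + (2 + 3)) _ _ _ _ _ (fun s q => q));
      last by rewrite /=; lia.
    apply: runs_seq; apply: (runs_weaken (rowP (Ordinal iN) _ _)).
    + by [].
    + exact: leqnn.
    move=> s' [pres ms' outs' s14'].
    apply: runs_seq; apply: runs_block; rewrite /= /update /=.
      by rewrite !pres //= s0 s2; lia.
    have fl : flatten [seq char_vector (non_neighbours e v)
                      | v <- rcons (seen i) (Ordinal iN)] =
        out s ++ char_vector (non_neighbours e (Ordinal iN)).
      by rewrite map_rcons flatten_rcons outs.
    apply: runs_if; rewrite /= /update /= s14'.
      rewrite -lt0n -has_count => hasv.
      apply: runs_skip => //.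
      rewrite /ready /= /update /= !pres //=; split=> //; split.
      * by rewrite s0 s2 size_rcons addn1.
      * by rewrite s6 -cats1 has_cat /= /isolated hasv !orbF.
      * by rewrite outs' fl.
    move=> /eqP; rewrite -leqn0 leqNgt -has_count => hasv.
    apply: runs_block; rewrite /= /update /=; first by lia.
    rewrite /ready /= /update /= !pres //=; split=> //; split.
    * by rewrite s0 s2 size_rcons addn1.
    * by rewrite -cats1 has_cat /= /isolated hasv orbT.
    * by rewrite outs' fl.
  rewrite /M seenS; case: ifP => // iK _.
  by apply: runs_skip.
- by move=> s [_ [_ ->]]; rewrite subnn.
rewrite /J /ready /= /update /= w_n /seen take0 mul0n !addn0 addn1 subn0.
by split.
Qed.

End Correctness.

(** * Layout of the input in memory *)

Lemma nth_map_enum_ord (A : Type) (x0 : A) n (F : 'I_n -> A) (i : 'I_n) :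
  nth x0 [seq F j | j <- enum 'I_n] i = F i.
Proof. by rewrite (nth_map i) ?size_enum_ord // nth_ord_enum. Qed.

Lemma nth_flatten_index (A : Type) (x0 : A) (ss : seq (seq A)) i k :
  k < size (nth [::] ss i) ->
  nth x0 (flatten ss) (sumn (take i (shape ss)) + k) = nth x0 (nth [::] ss i) k.
Proof.
elim: ss i => [|s ss IHss] [|i] //= ks; rewrite nth_cat ?ks //.
by rewrite -addnA ltnNge leq_addr /= addKn IHss.
Qed.

Lemma nth_char_vector n (A : {set 'I_n}) (i : 'I_n) :
  nth 0 (char_vector A) i = (i \in A).
Proof. exact: nth_map_enum_ord. Qed.

Lemma size_char_vector n (A : {set 'I_n}) : size (char_vector A) = n.
Proof. by rewrite size_map size_enum_ord. Qed.

Lemma nth_adj_matrix n (e : rel 'I_n) (i j : 'I_n) :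
  nth 0 (adj_matrix e) (i * n + j) = e i j.
Proof.
(* The matrix is by definition the flattening of its rows, and the first [i] rows have total length
   [i * n]. *)
have -> : i * n = sumn (take i (shape
    [seq [seq nat_of_bool (e i j) | j <- enum 'I_n] | i <- enum 'I_n])).
  rewrite /shape -map_comp (@eq_map _ _ _ (fun=> n)); last first.
    by move=> k /=; rewrite size_map size_enum_ord.
  have -> (l : seq 'I_n) : [seq n | _ <- l] = nseq (size l) n.
    by elim: l => //= _ l ->.
  by rewrite size_enum_ord take_nseq ?sumn_nseq 1?mulnC // ltnW.
by rewrite nth_flatten_index !nth_map_enum_ord // size_map size_enum_ord.
Qed.

Section Encoding.
Variables (n : nat) (K : {set 'I_n}) (r : seq nat).
Let w := n :: char_vector K ++ r.

Lemma nth_encoding_K (i : 'I_n) : nth 0 w i.+1 = (i \in K).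
Proof. by rewrite /= nth_cat size_char_vector ltn_ord nth_char_vector. Qed.

Lemma nth_encoding_graph a : nth 0 w (n.+1 + a) = nth 0 r a.
Proof. by rewrite /= nth_cat size_char_vector ltnNge leq_addr addKn. Qed.

End Encoding.

(** * The row routine for adjacency matrices *)

Definition matrix_row : cmd := Seq (block [:: Add 9 5 8]) emit_row.

Section MatrixRow.
Variables (n : nat) (e : rel 'I_n) (K : {set 'I_n}) (W : nat).
Let w := n :: char_vector K ++ adj_matrix e.
Hypothesis (W_large : n * n + 4 * n + 3 < W).

Lemma matrix_row_correct : row_correct AdjMatrix e K w W matrix_row 11.
Proof.
move=> v s [ms s5 _ [s1 s2 s8]]; rewrite /= in s5.
have vn : v * n + n <= n * n by rewrite addnC -mulSn leq_mul2r ltn_ord orbT.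
apply: (@runs_weaken _ _ _ (2 + (11 * n + 5)) _ _ _ _ _ (fun s q => q)); last lia.
apply: runs_seq; apply: runs_block; first by rewrite /= s5 s8; lia.
apply: (runs_weaken (runs_emit_row (b := e v) (k := [in K]) _ _ _ _ _ _ _)).
- lia.
- by rewrite /= /update /= s5 s8; lia.
- exact: s1.
- exact: s2.
- exact: s8.
- move=> j; rewrite /= /update /= s5 s8 ms addn0 -addnA nth_encoding_graph.
  exact: nth_adj_matrix.
- by move=> j; rewrite /= ms nth_encoding_K.
- exact: leqnn.
move=> s' [pres ms' outs' s14']; split=> //.
- move=> x x9; rewrite pres //= /update; case: eqP => //; lia.
- by move=> a; rewrite ms' /= ms.
- by rewrite outs' /=; congr (_ ++ _); apply: eq_map => j; rewrite inE.
Qed.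

End MatrixRow.

(* The neighbours are marked in the zero cells behind the input, so that the
   marks can be output as a matrix row; then they are erased again. *)
Definition list_row : cmd :=
  Seq (block [:: Read 15 5; Add 16 5 2; Read 16 16; Sub 16 16 15])
 (Seq (While 16 (block [:: Read 12 15; Add 12 12 7; Write 12 2;
                           Add 15 15 2; Sub 16 16 2]))
 (Seq (block [:: Add 9 7 8])
 (Seq emit_row
 (Seq (block [:: Add 9 7 8; Add 10 1 8])
      (While 10 (block [:: Write 9 8; Add 9 9 2; Sub 10 10 2])))))).

(** * The row routine for neighbour lists *)

Section ListRow.
Variables (n : nat) (e : rel 'I_n) (K : {set 'I_n}).
Variable adj : 'I_n -> seq 'I_n.
Hypothesis (uniq_adj : forall i, uniq (adj i)).
Let w := n :: char_vector K ++ adj_lists n.+1 adj.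
Let lists := [seq [seq nat_of_ord j | j <- adj i] | i <- enum 'I_n].
Let offset i := sumn (take i (shape lists)).

Lemma size_adj v : size (adj v) <= n.
Proof. by rewrite -(card_uniqP (uniq_adj v)) -[leqRHS]card_ord max_card. Qed.

Let size_lists : size lists = n.
Proof. by rewrite size_map size_enum_ord. Qed.

Let offset0 : offset 0 = 0. Proof. by rewrite /offset take0. Qed.

Let offsetS (v : 'I_n) : offset v.+1 = offset v + size (adj v).
Proof.
rewrite /offset (take_nth 0) ?sumn_rcons; last by rewrite size_map size_lists.
by rewrite (nth_map [::]) ?size_lists // nth_map_enum_ord size_map.
Qed.

Let offset_le i : i <= n -> offset i <= i * n.
Proof.
elim: i => [|i IHi] lt_i_n; first by rewrite offset0.
rewrite (offsetS (Ordinal lt_i_n)) /= mulSn addnC leq_add ?size_adj //.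
by rewrite IHi // ltnW.
Qed.

Let offset_n : offset n = size (flatten lists).
Proof.
by rewrite size_flatten /offset take_oversize // size_map size_lists.
Qed.

Lemma nth_list_pointer i : i <= n -> nth 0 w (n.+1 + i) = n.+1 + n.+1 + offset i.
Proof.
move=> le_i_n; rewrite nth_encoding_graph nth_cat size_map size_iota ltnS le_i_n.
by rewrite (nth_map 0) ?size_iota ?ltnS // nth_iota.
Qed.

Lemma nth_list_neighbour (v : 'I_n) k (lt_k : k < size (adj v)) :
  nth 0 w (n.+1 + n.+1 + offset v + k) = nth v (adj v) k.
Proof.
rewrite -!addnA nth_encoding_graph nth_cat size_map size_iota ltnNge leq_addr /=.
rewrite addKn nth_flatten_index nth_map_enum_ord ?size_map //.
by rewrite (nth_map v).
Qed.

(** The last list pointer, where the input ends and the scratch area of n cells begins. *)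
Let B := nth 0 w (n + n.+1).

Let defB : B = n.+1 + n.+1 + offset n.
Proof. by rewrite /B addnC nth_list_pointer. Qed.

Lemma list_scratch_le : B + n <= n * n + 3 * n + 2.
Proof. by rewrite defB; have := offset_le (leqnn n); lia. Qed.

(** Behind the input, memory holds the default value of [nth], so the scratch area starts out
    clean. *)
Lemma nth_scratch a : B <= a -> nth 0 w a = 0.
Proof.
move=> le_B; apply: nth_default; apply: leq_trans le_B.
rewrite defB offset_n /= size_cat size_char_vector size_cat size_map size_iota.
by rewrite -/lists; lia.
Qed.

Definition marked (l : seq 'I_n) (a : nat) : nat :=
  if a \in [seq B + nat_of_ord j | j <- l] then 1 else nth 0 w a.

Lemma marked_lt l a : a < B -> marked l a = nth 0 w a.
Proof. by move=> lt_a; rewrite /marked; case: mapP => // -[j _ ja]; lia. Qed.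

Lemma marked_scratch l (j : 'I_n) : marked l (B + j) = (j \in l).
Proof.
have inj_f : injective (fun j : 'I_n => B + j) by move=> i k /addnI/val_inj.
rewrite /marked (mem_map inj_f l j).
by case: ifP => // _; rewrite nth_scratch ?leq_addr.
Qed.

Lemma marked_rcons l (j : 'I_n) f : f =1 marked l ->
  update f (j + B) 1 =1 marked (rcons l j).
Proof.
move=> fl a; rewrite /update /marked map_rcons mem_rcons inE (addnC j) fl.
by case: (a == _).
Qed.

Variable W : nat.
Hypothesis (mem_adj : forall i j, (j \in adj i) = e i j).
Hypothesis (W_large : n * n + 4 * n + 3 < W).

Lemma list_row_correct : row_correct AdjLists e K w W list_row 23.
Proof.
move=> v s [ms s5 s7 [s1 s2 s8]]; rewrite /= muln1 in s5; rewrite -/B in s7.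
have vn := ltn_ord v; have sizev := size_adj v.
have Ble := list_scratch_le.
have ptr1 := nth_list_pointer (ltnW vn).
have ptr2 : nth 0 w (n.+1 + v + 1) = n.+1 + n.+1 + offset v + size (adj v).
  by rewrite -addnA addn1 nth_list_pointer // offsetS addnA.
have offv : offset v + size (adj v) <= offset n.
  rewrite -offsetS offset_n size_flatten -[in leqRHS](cat_take_drop v.+1 (shape lists)).
  by rewrite sumn_cat leq_addr.
have vB : n.+1 + v < B by rewrite defB; lia.
pose I1 i s' := [/\ preserved s s', out s' = out s,
  mem s' =1 marked (take i (adj v)),
  vars s' 15 = n.+1 + n.+1 + offset v + i & vars s' 16 = size (adj v) - i].
pose I2 s' := [/\ preserved s s', mem s' =1 marked (adj v),
  out s' = out s ++ char_vector (non_neighbours e v)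
  & vars s' 14 = count (fun u => e v u && (u \notin K)) (enum 'I_n)].
pose I3 i s' := [/\ preserved s s',
  (forall a, mem s' a = if B <= a < B + i then 0 else marked (adj v) a),
  out s' = out s ++ char_vector (non_neighbours e v),
  vars s' 14 = count (fun u => e v u && (u \notin K)) (enum 'I_n)
  & vars s' 9 = B + i /\ vars s' 10 = n - i].
(* The degree is at most n, so marking, output and erasure take 7n, 11n and 5n steps up to
   constants, whence the 23. *)
apply: (@runs_weaken _ _ _ (5 + ((size (adj v) * 7).+1 +
  (2 + (11 * n + 5 + (3 + (n * 5).+1))))) _ _ _ _ _ (fun s q => q)); last lia.
apply: runs_seq; apply: runs_block.
  by rewrite /= /update /= !ms s5 s2 ptr1 ptr2; lia.
apply: runs_seq; apply: (@runs_weaken _ _ _ _ _ (I1 (size (adj v)))); last 2 first.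
- exact: leqnn.
- move=> s' [pres outs' ms' _ _]; rewrite take_size in ms'.
  have [[p1 p2] [p7 p8]] := ((pres 1 isT, pres 2 isT), (pres 7 isT, pres 8 isT)).
  rewrite s1 s2 s7 s8 in p1 p2 p7 p8.
  apply: runs_seq; apply: runs_block; first by rewrite /= p7 p8; lia.
  apply: runs_seq; apply: (@runs_weaken _ _ _ _ _ I2); last 2 first.
  + exact: leqnn.
  + move=> s2' [pres2 ms2 outs2 s14].
    have [[q1 q2] [q7 q8]] :=
      ((pres2 1 isT, pres2 2 isT), (pres2 7 isT, pres2 8 isT)).
    rewrite s1 s2 s7 s8 in q1 q2 q7 q8.
    apply: runs_seq; apply: runs_block; first by rewrite /= /update /= q7 q8 q1; lia.
    apply: (@runs_weaken _ _ _ _ _ (I3 n)); last 2 first.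
    * exact: leqnn.
    (* All n scratch cells are cleared; every mark lies among them, so the original memory is
       back. *)
    * move=> s3 [pres' ms3 outs3 s14' _]; split=> // a; rewrite ms3.
      case: ifP => [/andP[le_B _]|nB]; first by rewrite nth_scratch.
      rewrite /marked; case: mapP => // -[j _ aj].
      by have := ltn_ord j; lia.
    apply: runs_while_const => [i s3 iN [pres3 ms3 outs3 s14' [s9 s10]]||].
    * split; first by rewrite s10; lia.
      have [r2 r8] := (pres3 2 isT, pres3 8 isT); rewrite s2 s8 in r2 r8.
      apply: runs_block; rewrite /= /update /= s9 s10 r2 ?r8; first by lia.
      split=> //=; last by split; lia.
        by move=> x x9 /=; rewrite -pres3 //; do ![case: eqP => [?|_]; first lia].
      move=> a; rewrite ms3; have [->|na] := eqVneq a (B + i).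
        by rewrite leq_addr addnS ltnS leqnn.
      by congr (if _ then _ else _); lia.
    * by move=> s3 [_ _ _ _ [_ ->]]; rewrite subnn.
    split=> //=; last by rewrite /update /= q1 q7 q8 addn0 subn0 addn0.
      by move=> x x9; rewrite /= /update -pres2 //; do ![case: eqP => [?|_]; first lia].
    by move=> a; rewrite ms2 addn0 ltnNge andbN.
  apply: (runs_weaken (runs_emit_row (b := e v) (k := [in K]) _ _ _ _ _ _ _)).
  + lia.
  + by rewrite /= /update /= p7 p8; lia.
  + exact: p1.
  + exact: p2.
  + exact: p8.
  + by move=> j; rewrite /= /update /= ms' p7 p8 addn0 marked_scratch mem_adj.
  + move=> j; rewrite /= ms' marked_lt ?nth_encoding_K //.
    by have := ltn_ord j; rewrite defB; lia.
  + exact: leqnn.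
  move=> s2' [pres2 ms2 outs2 s14]; split=> //.
  + move=> x x9; rewrite pres2 //= /update -pres //; case: eqP => //; lia.
  + by move=> a; rewrite ms2 /= ms'.
  + by rewrite outs2 /= outs'; congr (_ ++ _); apply: eq_map => j; rewrite inE.
apply: runs_while_const => [i s' iN [pres outs' ms' s15 s16]||].
- split; first by rewrite s16; lia.
  have [p2 p7] := (pres 2 isT, pres 7 isT); rewrite s2 s7 in p2 p7.
  have nb := nth_list_neighbour iN; have lt_nb := ltn_ord (nth v (adj v) i).
  (* The lists lie below [B], so the marks made so far do not affect the neighbours still to be
     read. *)
  have rd : mem s' (n.+1 + n.+1 + offset v + i) = nth v (adj v) i.
    by rewrite ms' marked_lt // defB; lia.
  apply: runs_block; rewrite /= /update /= s15 s16 rd p2 p7; first by lia.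
  split=> //=; last by lia.
  + by move=> x x9 /=; rewrite -pres //; do ![case: eqP => [?|_]; first lia].
  + rewrite (take_nth v) //; exact: marked_rcons.
  + lia.
- by move=> s' [_ _ _ _ ->]; rewrite subnn.
split=> //=.
- by move=> x x9; rewrite /= /update; do ![case: eqP => [?|_]; first lia].
- by move=> a; rewrite ms take0.
- by rewrite /update /= ms s5 ptr1 addn0.
- rewrite /update /= !ms s5 s2 ptr1 ptr2 subn0; lia.
Qed.

End ListRow.

(** * Both formats together, and the final bound *)

Definition row_program (fmt : graph_format) : cmd :=
  if fmt is AdjMatrix then matrix_row else list_row.

Lemma row_program_correct fmt n (e : rel 'I_n) (K : {set 'I_n}) w W :
  n * n + 4 * n + 3 < W -> encodes fmt e K w ->
  row_correct fmt e K w W (row_program fmt) (if fmt is AdjMatrix then 11 else 23).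
Proof.
case: fmt => /= W_large; first by move=> ->; apply: matrix_row_correct.
by move=> [adj [uniq_adj mem_adj ->]]; apply: list_row_correct.
Qed.

(** The bound ensures that loading variable 7 does not overflow in either format; for a matrix, the
    word read is an entry or the default 0. *)
Lemma encodes_header fmt n (e : rel 'I_n) (K : {set 'I_n}) w :
  encodes fmt e K w -> exists2 r, w = n :: char_vector K ++ r &
    nth 0 w (n + n.+1) <= n * n + 3 * n + 2.
Proof.
case: fmt => [->|[adj [uniq_adj mem_adj ->]]].
  exists (adj_matrix e) => //; rewrite addnC nth_encoding_graph.
  have [lt_n|le_n] := ltnP n (size (adj_matrix e)); last by rewrite nth_default.
  suff /allP/(_ _ (mem_nth 0 lt_n)) /= : all (leq^~ 1) (adj_matrix e).
    by move/leq_trans; apply; lia.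
  by apply/allP => _ /allpairsP[[i j] [_ _ ->]]; case: (e _ _).
exists (adj_lists n.+1 adj) => //.
exact: leq_trans (leq_addr n _) (list_scratch_le K uniq_adj).
Qed.

Theorem theorem3p22 :
  (forall (T : finType) (e : rel T), simple_graph e -> split_graph e ->
     #|max_indep_sets e| = omega e \/ #|max_indep_sets e| = omega e + 1)
  /\
  (forall fmt : graph_format,
     exists (p : cmd) (c d : nat),
       forall (n : nat) (e : rel 'I_n) (K S : {set 'I_n}) (w : seq nat),
         simple_graph e -> split_partition e K S -> encodes fmt e K w ->
         exists (t : nat) (s : state),
           [/\ exec ((n + 2) ^ d) p (init w) t s,
               vars s 0 = #|max_indep_sets e|,
               enumerates (max_indep_sets e) (out s)
             & 0 < n -> t <= c * (omega e * n)]).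
Proof.
split=> [T e simple_e [K [S splitKS]] | fmt].
  exact: card_max_indep_sets_omega splitKS.
(* For n > 0, each of n, 1, |K| n and |K| is at most omega n, so 24 n + 25 + (23 n + 23) |K| is at
   most (24 + 25 + 23 + 23) omega n. The exponent 2 works because (n + 2)^2 exceeds n^2 + 4 n + 3 by
   one. *)
exists (mis_program fmt (row_program fmt)), 95, 2 => n e K S w simple_e splitKS enc.
have W_large : n * n + 4 * n + 3 < (n + 2) ^ 2 by rewrite expnS expn1; lia.
have [r def_w scratch_le] := encodes_header enc.
have rowP := row_program_correct W_large enc.
have [||i|t [s [ex le_t [s0 outs]]]] :=
  runs_mis_program simple_e splitKS W_large _ _ _ rowP.
- by rewrite def_w.
- lia.
- by rewrite def_w nth_encoding_K.
exists t, s; split=> // n_gt0; apply: leq_trans le_t _.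
have Kom := card_le_omega splitKS.
have le_n : n <= omega e * n by rewrite leq_pmull // omega_gt0 ?card_ord.
have le_Kn : #|K| * n <= omega e * n by rewrite leq_mul2r Kom orbT.
have le_K : #|K| <= #|K| * n by rewrite leq_pmulr.
case: (fmt); nia.
Qed.
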